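(* For all integers $n\ge 0$, $$\hat{F}_{n+1}(y)=\sum_{k=0}^{\lfloor \frac{n}{2} \rfloor} \tilde{\tilde{t}}_{n,k}\,y^{n-2k}=\sum_{k=0}^{\lfloor \frac{n}{2} \rfloor} \binom{n}{2k}C_k(-1)^{n-k}y^{n-2k}.$$
   Context: The Fibonacci polynomials $F_n(y)$, $n\ge 0$, are defined by the generating function $\sum_{n\ge 0}F_n(y)x^n = F(x,y)=\frac{x}{1-yx-x^2}$. The dual Fibonacci polynomials $\hat F_n(y)$, $n\ge 0$, are the polynomials defined by $\sum_{n\ge0}\hat F_n(y)x^n=u(x)$, where $u(x)$ is the compositional inverse (series reversion) of $F(x,y)$ with respect to $x$, i.e. the unique formal power series in $x$ with coefficients in $\mathbb{Q}[y]$ such that $u(0)=0$ and $\frac{u}{1-yu-u^2}=x$. The numbers $\tilde{\tilde t}_{n,k}$ ($n,k\ge0$) are the entries of the inversion of the matrix $\left(\binom{n-k}{k}\right)_{n,k\ge 0}$: they are defined by $\sum_{n,k\ge0}\tilde{\tilde t}_{n,k}x^ny^k=\frac{v(x)}{x}$, where $v(x)$ is the unique formal power series in $x$ with coefficients in $\mathbb{Q}[y]$ such that $v(0)=0$ and $\frac{v}{1-v-yv^2}=x$. $C_k=\frac{1}{k+1}\binom{2k}{k}$ is the $k$-th Catalan number. *)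

(* Defs.v *)
(* MathComp; mathcomp-classical supplies funext and choice on nat -> R. *)
From HB Require Import structures.
From mathcomp Require Import all_boot all_order all_algebra.
From mathcomp Require Import boolp classical_sets.

Set Implicit Arguments.
Unset Strict Implicit.
Unset Printing Implicit Defensive.

Import GRing.Theory.
Local Open Scope ring_scope.

(* The sequence determined by a_n = step [:: a_0; ...; a_(n-1)].              *)
Section CourseOfValues.
Variables (R : nzRingType) (step : seq R -> R).

Fixpoint cov_prefix (n : nat) : seq R :=
  if n is m.+1 then rcons (cov_prefix m) (step (cov_prefix m)) else [::].

Definition cov (n : nat) : R := step (cov_prefix n).

Lemma size_cov_prefix n : size (cov_prefix n) = n.
Proof. by elim: n => //= n IH; rewrite size_rcons IH. Qed.

Lemma nth_cov_prefix n i :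
  nth 0 (cov_prefix n) i = if (i < n)%N then cov i else 0.
Proof.
elim: n => [|n IH] /=; first by rewrite nth_nil.
rewrite nth_rcons size_cov_prefix IH [(i < n.+1)%N]ltnS.
by case: ltngtP => //= ->.
Qed.

End CourseOfValues.

(* Formal power series sum_n (f n) x^n with coefficients in R.                *)
Record fps (R : Type) := Fps { fpscoef : nat -> R }.
Coercion fpscoef : fps >-> Funclass.

HB.instance Definition _ (R : Type) := [isNew for @fpscoef R].
HB.instance Definition _ (R : eqType) := [Equality of fps R by <:].
HB.instance Definition _ (R : choiceType) := [Choice of fps R by <:].

Lemma fpsP (R : Type) (f g : fps R) : (forall n, f n = g n) <-> f = g.
Proof.
split=> [|->//]; case: f => f; case: g => g /= E.
by congr Fps; apply: funext.
Qed.

Section FpsZmod.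
Variable R : zmodType.
Implicit Types f g h : fps R.

Definition fps_zero : fps R := Fps (fun=> 0).
Definition fps_opp f : fps R := Fps (fun n => - f n).
Definition fps_add f g : fps R := Fps (fun n => f n + g n).

Fact fps_addA : associative fps_add.
Proof. by move=> f g h; apply/fpsP => n; apply: addrA. Qed.
Fact fps_addC : commutative fps_add.
Proof. by move=> f g; apply/fpsP => n; apply: addrC. Qed.
Fact fps_add0 : left_id fps_zero fps_add.
Proof. by move=> f; apply/fpsP => n; apply: add0r. Qed.
Fact fps_addN : left_inverse fps_zero fps_opp fps_add.
Proof. by move=> f; apply/fpsP => n; apply: addNr. Qed.

HB.instance Definition _ :=
  GRing.isZmodule.Build (fps R) fps_addA fps_addC fps_add0 fps_addN.

Lemma fps0E n : (0 : fps R) n = 0. Proof. by []. Qed.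
Lemma fpsDE f g n : (f + g) n = f n + g n. Proof. by []. Qed.
Lemma fpsNE f n : (- f) n = - f n. Proof. by []. Qed.
Lemma fpsBE f g n : (f - g) n = f n - g n. Proof. by []. Qed.

End FpsZmod.

HB.lock Definition fps_mul (R : comNzRingType) (f g : fps R) : fps R :=
  Fps (fun n => \sum_(i < n.+1) f i * g (n - i)%N).

Section FpsRing.
Variable R : comNzRingType.
Implicit Types f g h u : fps R.

Definition fps_one : fps R := Fps (fun n => (n == 0)%:R).

Let fps_mulE f g n : fps_mul f g n = \sum_(i < n.+1) f i * g (n - i)%N.
Proof. by rewrite fps_mul.unlock. Qed.

Definition fps_scale (a : R) f : fps R := Fps (fun n => a * f n).

Let trunc N f : {poly R} := \poly_(i < N) f i.

Let truncM N f g n : (n < N)%N -> (trunc N f * trunc N g)`_n = fps_mul f g n.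
Proof.
move=> nN; rewrite coefM fps_mulE; apply: eq_bigr => i _.
have iN : (i < N)%N by apply: leq_ltn_trans nN; rewrite -ltnS.
by rewrite !coef_poly iN (leq_ltn_trans (leq_subr _ _) nN).
Qed.

Let coefM_eq (p p' q q' : {poly R}) n :
  (forall i, (i <= n)%N -> p`_i = p'`_i) ->
  (forall i, (i <= n)%N -> q`_i = q'`_i) -> (p * q)`_n = (p' * q')`_n.
Proof.
move=> E1 E2; rewrite !coefM; apply: eq_bigr => i _.
by rewrite E1 ?E2 ?leq_subr // -ltnS.
Qed.

Fact fps_mulC : commutative (@fps_mul R).
Proof.
move=> f g; apply/fpsP => n.
by rewrite -!(@truncM n.+1) // mulrC.
Qed.

Fact fps_mulA : associative (@fps_mul R).
Proof.
move=> f g h; apply/fpsP => n; rewrite -!(@truncM n.+1) //.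
have E a b i : (i <= n)%N ->
    (trunc n.+1 (fps_mul a b))`_i = (trunc n.+1 a * trunc n.+1 b)`_i.
  by move=> le_in; rewrite truncM // coef_poly ltnS le_in.
rewrite (@coefM_eq _ (trunc n.+1 f) _ (trunc n.+1 g * trunc n.+1 h)) //; last exact: E.
rewrite mulrA; apply/esym.
by apply: coefM_eq => // i; apply: E.
Qed.

Fact fps_mul1 : left_id fps_one (@fps_mul R).
Proof.
move=> f; apply/fpsP => n.
rewrite fps_mulE big_ord_recl /= mul1r subn0 big1 ?addr0 // => i _.
by rewrite mul0r.
Qed.

Fact fps_mulDl : left_distributive (@fps_mul R) +%R.
Proof.
move=> f g h; apply/fpsP => n; rewrite fpsDE !fps_mulE -big_split.
by apply: eq_bigr => i _; rewrite mulrDl.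
Qed.

Fact fps_one_neq0 : fps_one != 0.
Proof. by apply/eqP => /fpsP/(_ 0)/eqP; rewrite oner_eq0. Qed.

HB.instance Definition _ := GRing.Zmodule_isComNzRing.Build (fps R)
  fps_mulA fps_mulC fps_mul1 fps_mulDl fps_one_neq0.

Fact fps_scaleA a b f : fps_scale a (fps_scale b f) = fps_scale (a * b) f.
Proof. by apply/fpsP => n; apply: mulrA. Qed.
Fact fps_scale1 : left_id 1 fps_scale.
Proof. by move=> f; apply/fpsP => n; apply: mul1r. Qed.
Fact fps_scaleDr : right_distributive fps_scale +%R.
Proof. by move=> a f g; apply/fpsP => n; apply: mulrDr. Qed.
Fact fps_scaleDl f : {morph fps_scale^~ f : a b / a + b}.
Proof. by move=> a b; apply/fpsP => n; apply: mulrDl. Qed.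

HB.instance Definition _ := GRing.Zmodule_isLmodule.Build R (fps R)
  fps_scaleA fps_scale1 fps_scaleDr fps_scaleDl.

Fact fps_scaleAl (a : R) f g : a *: (f * g) = a *: f * g.
Proof.
apply/fpsP => n; rewrite /= !fps_mulE big_distrr /=.
by apply: eq_bigr => i _; rewrite mulrA.
Qed.

HB.instance Definition _ :=
  GRing.Lmodule_isLalgebra.Build R (fps R) fps_scaleAl.
HB.instance Definition _ := GRing.Lalgebra_isComAlgebra.Build R (fps R).

Definition fpsX : fps R := Fps (fun n => (n == 1)%:R).

(* The formal quotient f / x; meaningful when f 0 = 0, see fpsX_divX.         *)
Definition fps_divX f : fps R := Fps (fun n => f n.+1).

Lemma fps1E n : (1 : fps R) n = (n == 0)%:R. Proof. by []. Qed.
Lemma fpsME f g n : (f * g) n = \sum_(i < n.+1) f i * g (n - i)%N.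
Proof. exact: fps_mulE. Qed.
Lemma fpsZE a f n : (a *: f) n = a * f n. Proof. by []. Qed.
Lemma fpsXE n : fpsX n = (n == 1)%:R. Proof. by []. Qed.

Lemma fpsM0 f g : (f * g) 0 = f 0 * g 0.
Proof. by rewrite fpsME big_ord1. Qed.

Lemma fpsXM f n : (fpsX * f) n = if n is m.+1 then f m else 0.
Proof.
case: n => [|n]; first by rewrite fpsM0 mul0r.
rewrite fpsME big_ord_recl mul0r add0r big_ord_recl /= mul1r subSS subn0.
by rewrite big1 ?addr0 // => i _; rewrite mul0r.
Qed.

Lemma fpsX_divX f : f 0 = 0 -> fpsX * fps_divX f = f.
Proof. by move=> f0; apply/fpsP => -[|n]; rewrite fpsXM. Qed.

Lemma fps_sumE (I : Type) (r : seq I) (P : pred I) (F : I -> fps R) n :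
  (\sum_(i <- r | P i) F i) n = \sum_(i <- r | P i) F i n.
Proof. by elim/big_rec2: _ => // i a b _ <-; rewrite fpsDE. Qed.

End FpsRing.

Arguments fpsX {R}.

(* Composition f(u(x)). The definition is the intended one only for u 0 = 0:  *)
(* then u^k has no term of degree < k, so the sum may stop at k = n.          *)
HB.lock Definition fps_comp (R : comNzRingType) (f u : fps R) : fps R :=
  Fps (fun n => \sum_(k < n.+1) f k * (u ^+ k) n).

Section FpsComp.
Variable R : comNzRingType.
Implicit Types f g u : fps R.

Lemma fps_compcoef f u n : fps_comp f u n = \sum_(k < n.+1) f k * (u ^+ k) n.
Proof. by rewrite fps_comp.unlock. Qed.

Lemma fpsX_low u k n : u 0 = 0 -> (n < k)%N -> (u ^+ k) n = 0.
Proof.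
move=> u0; elim: k n => // k IH n nk; rewrite exprS fpsME big1 // => i _.
case: i => [[|i] /= lin]; first by rewrite u0 mul0r.
by rewrite IH ?mulr0 //; move: lin nk; rewrite !ltnS; case: n => // n _; rewrite subSS => h; apply: leq_ltn_trans h; rewrite leq_subr.
Qed.

Lemma fps_compE f u n N : u 0 = 0 -> (n < N)%N ->
  fps_comp f u n = \sum_(k < N) f k * (u ^+ k) n.
Proof.
move=> u0 nN; rewrite fps_compcoef [RHS](big_ord_widen_cond N xpredT
  (fun k => f k * (u ^+ k) n)) // [RHS](bigID (fun k : 'I_N => (k < n.+1)%N)) /=.
rewrite [X in _ + X]big1 ?addr0; last first.
  by move=> k; rewrite -leqNgt => /andP[_ nk]; rewrite fpsX_low ?mulr0.
rewrite (big_ord_widen N (fun k => f k * (u ^+ k) n)) //.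
by apply: eq_bigl => i; rewrite ltn_ord.
Qed.

Lemma fps_compD f g u : fps_comp (f + g) u = fps_comp f u + fps_comp g u.
Proof.
apply/fpsP => n; rewrite fpsDE !fps_compcoef -big_split /=.
by apply: eq_bigr => i _; rewrite mulrDl.
Qed.

Lemma fps_compZ a f u : fps_comp (a *: f) u = a *: fps_comp f u.
Proof.
apply/fpsP => n; rewrite fpsZE !fps_compcoef big_distrr /=.
by apply: eq_bigr => i _; rewrite mulrA.
Qed.

Lemma fps_compN f u : fps_comp (- f) u = - fps_comp f u.
Proof. by rewrite -scaleN1r fps_compZ scaleN1r. Qed.

Lemma fps_compXM f u : u 0 = 0 -> fps_comp (fpsX * f) u = u * fps_comp f u.
Proof.
move=> u0; apply/fpsP => n.
rewrite (@fps_compE _ _ n n.+2) // big_ord_recl fpsXM mul0r add0r.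
transitivity ((u * (\sum_(k < n.+1) f k *: u ^+ k)) n).
  rewrite mulr_sumr fps_sumE; apply: eq_bigr => k _.
  by rewrite fpsXM -scalerAr fpsZE exprS.
rewrite !fpsME; apply: eq_bigr => i _; congr (_ * _).
rewrite (@fps_compE _ _ _ n.+1) ?ltnS ?leq_subr // fps_sumE.
by apply: eq_bigr => k _; rewrite fpsZE.
Qed.

Lemma fps_compX u : u 0 = 0 -> fps_comp fpsX u = u.
Proof.
move=> u0; rewrite -[fpsX]mulr1 fps_compXM //.
suff -> : fps_comp 1 u = 1 by rewrite mulr1.
apply/fpsP => n; rewrite fps_compcoef big_ord_recl big1 => [|i _]; last by rewrite mul0r.
by rewrite addr0 mul1r expr0.
Qed.

Definition fps_below n u : fps R := Fps (fun i => if (i < n)%N then u i else 0).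

(* The n-th coefficient of f(u) is (f 1) * (u n) plus a term depending only   *)
(* on the coefficients u i, i < n.                                            *)
Lemma comp_below f u n : f 0 = 0 -> u 0 = 0 ->
  fps_comp f u n = f 1 * u n + fps_comp f (fps_below n u) n.
Proof.
move=> f0 u0; case: n => [|n]; first by rewrite !fps_compcoef !big_ord1 f0 !mul0r u0 mulr0 addr0.
have b0 : fps_below n.+1 u 0 = 0 by rewrite /= u0.
have powE k i : (i <= n)%N -> (u ^+ k) i = (fps_below n.+1 u ^+ k) i.
  elim: k i => // k IH i le_in; rewrite !exprS !fpsME; apply: eq_bigr => j _.
  have le_jn : (j <= n)%N by apply: leq_trans le_in; rewrite -ltnS.
  by rewrite IH ?(leq_trans (leq_subr _ _) le_in) //= ltnS le_jn.
have powE2 k : (u ^+ k.+2) n.+1 = (fps_below n.+1 u ^+ k.+2) n.+1.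
  rewrite ![_ ^+ k.+2]exprS !fpsME big_ord_recl [RHS]big_ord_recl.
  rewrite u0 b0 !mul0r !add0r big_ord_recr [RHS]big_ord_recr.
  rewrite !lift0 subnn !fpsX_low // !mulr0; congr (_ + _).
  apply: eq_bigr => j _; rewrite lift0 subSS -powE ?leq_subr //.
  by rewrite /= ltnS ltn_ord.
rewrite !(@fps_compE _ _ _ n.+2) // !big_ord_recl f0 !mul0r !add0r !lift0.
rewrite !expr1 [fps_below _ _ _]/= ltnn mulr0 add0r.
by congr (_ + _); apply: eq_bigr => i _; rewrite !lift0 powE2.
Qed.

End FpsComp.

Definition fps_unit (R : comUnitRingType) : pred (fps R) :=
  fun f => f 0 \is a GRing.unit.

(* Coefficients of 1/f, solving sum_(i <= n) (f i) (g (n - i)) = [n = 0].     *)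
HB.lock Definition fps_inv (R : comUnitRingType) (f : fps R) : fps R :=
  if fps_unit f then
    Fps (cov (fun s => (f 0)^-1 *
      ((size s == 0)%:R - \sum_(i < size s) f i.+1 * s`_(size s - i.+1))))
  else f.

Section FpsUnit.
Variable R : comUnitRingType.
Implicit Types f g u v : fps R.

Fact fps_mulVx : {in @fps_unit R, left_inverse 1 (@fps_inv R) *%R}.
Proof.
move=> f fU; rewrite fps_inv.unlock; move: (fU); rewrite /in_mem /= => fU'; rewrite fU'.
set g := Fps _; rewrite mulrC; apply/fpsP => n.
rewrite fpsME big_ord_recl subn0 /= {1}/cov size_cov_prefix mulVKr //.
rewrite -[RHS]subr0 -addrA; congr (_ + _); apply/eqP; rewrite oppr0 addrC subr_eq0.
apply/eqP; apply: eq_bigr => i _; congr (_ * _).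
by rewrite nth_cov_prefix /= ltn_subrL /= (leq_ltn_trans _ (ltn_ord i)).
Qed.

Fact fps_unitP f g : g * f = 1 -> fps_unit f.
Proof.
move=> /fpsP/(_ 0); rewrite fpsM0 fps1E /= => gf; apply/unitrPr; exists (g 0).
by rewrite mulrC.
Qed.

Fact fps_inv_out : {in [predC @fps_unit R], @fps_inv R =1 id}.
Proof. by move=> f; rewrite inE /= /in_mem /= fps_inv.unlock => /negbTE ->. Qed.

HB.instance Definition _ := GRing.ComNzRing_hasMulInverse.Build (fps R)
  fps_mulVx fps_unitP fps_inv_out.

Lemma fps_unitE f : (f \is a GRing.unit) = (f 0 \is a GRing.unit).
Proof. by []. Qed.

Definition is_reversion f : set (fps R) :=
  [set u : fps R | u 0 = 0 /\ fps_comp f u = fpsX].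

(* "The" compositional inverse of f; it exists and is unique as soon as       *)
(* f 0 = 0 and f 1 is a unit (reversionP, reversion_unique).                  *)
Definition reversion f : fps R := xget 0 (is_reversion f).

Lemma reversion_ex f : f 0 = 0 -> f 1 \is a GRing.unit ->
  exists u, is_reversion f u.
Proof.
move=> f0 f1; pose step s : R :=
  (f 1)^-1 * ((size s == 1)%:R - fps_comp f (Fps (fun i => s`_i)) (size s)).
pose u := Fps (cov step).
have uE n : u n = (f 1)^-1 * ((n == 1)%:R - fps_comp f (fps_below n u) n).
  rewrite /= /cov /step size_cov_prefix; congr (_ * (_ - fps_comp f _ n)).
  by apply/fpsP => i /=; rewrite nth_cov_prefix.
have u0 : u 0 = 0 by rewrite uE fps_compcoef big_ord1 f0 mul0r subr0 mulr0.
exists u; split => //; apply/fpsP => n.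
by rewrite comp_below // uE mulVKr // subrK.
Qed.

Lemma reversion_unique f u v : f 0 = 0 -> f 1 \is a GRing.unit ->
  is_reversion f u -> is_reversion f v -> u = v.
Proof.
move=> f0 f1 [u0 fu] [v0 fv]; apply/fpsP => n.
elim/ltn_ind: n => n IH.
have /fpsP/(_ n) : fps_comp f u = fps_comp f v by rewrite fu fv.
rewrite (comp_below n f0 u0) (comp_below n f0 v0).
have -> : fps_below n u = fps_below n v.
  by apply/fpsP => i /=; case: ifP => // /IH.
by move/addIr/(mulrI f1).
Qed.

Lemma reversionP f : f 0 = 0 -> f 1 \is a GRing.unit ->
  reversion f 0 = 0 /\ fps_comp f (reversion f) = fpsX.
Proof. by move=> f0 f1; apply: (xgetPex 0 (reversion_ex f0 f1)). Qed.

(* f = x / (1 - a x - b x^2) composed with u is u / (1 - a u - b u^2).        *)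
Lemma fps_comp_quad (a b : R) u : u 0 = 0 ->
  fps_comp (fpsX / (1 - a *: fpsX - b *: fpsX ^+ 2)) u
  = u / (1 - a *: u - b *: u ^+ 2).
Proof.
move=> u0; set q := 1 - _ - _; set r := 1 - _ - _.
have qU : q \is a GRing.unit.
  by rewrite fps_unitE !fpsBE !fpsZE expr2 fpsM0 fpsXE mulr0 !mulr0 !subr0 unitr1.
have rU : r \is a GRing.unit.
  by rewrite fps_unitE !fpsBE !fpsZE expr2 fpsM0 u0 mulr0 !mulr0 !subr0 unitr1.
apply: (mulIr rU); rewrite divrK //.
set f := fpsX / q; have fq : fpsX = f - a *: (fpsX * f) - b *: (fpsX * (fpsX * f)).
  by rewrite -[LHS](divrK qU) -/f /q !mulrBr mulr1 -!scalerAr !(mulrC f) mulrA.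
rewrite -[in RHS](fps_compX u0) [in RHS]fq !(fps_compD, fps_compN, fps_compZ).
rewrite !fps_compXM // /r !mulrBr mulr1 -!scalerAr expr2.
by rewrite !(mulrC (u * fps_comp _ _)) !mulrA.
Qed.

(* x / (1 - a x - b x^2) satisfies the hypotheses of reversionP.              *)
Lemma quad_coef01 (a b : R) :
  let f := fpsX / (1 - a *: fpsX - b *: fpsX ^+ 2) in f 0 = 0 /\ f 1 = 1.
Proof.
move=> f; rewrite /f; split; first by rewrite fpsM0 mul0r.
set q := 1 - _ - _.
have q0 : q 0 = 1.
  by rewrite !fpsBE !fpsZE expr2 fpsM0 fpsXE mulr0 !mulr0 !subr0.
have qU : q \is a GRing.unit by rewrite fps_unitE q0 unitr1.
have /fpsP/(_ 0) : q^-1 * q = 1 by rewrite mulVr.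
by rewrite fpsM0 q0 mulr1 fpsXM /= => ->.
Qed.

End FpsUnit.

(* Q[y] is {poly rat}, with y = 'X; series in x over Q[y] are fps {poly rat}. *)
Local Notation y := ('X : {poly rat}).

Definition fibonacci_gf : fps {poly rat} :=
  fpsX / (1 - y *: fpsX - fpsX ^+ 2).

Definition dual_fibonacci_gf : fps {poly rat} := reversion fibonacci_gf.

Definition dual_fibonacci (n : nat) : {poly rat} := dual_fibonacci_gf n.

Definition is_inversion_gf : set (fps {poly rat}) :=
  [set v : fps {poly rat} | v 0 = 0 /\ v / (1 - v - y *: v ^+ 2) = fpsX].

Definition inversion_gf : fps {poly rat} := xget 0 is_inversion_gf.

(* Coefficient of x^n y^k in v(x)/x.                                          *)
Definition ttilde2 (n k : nat) : rat := (fps_divX inversion_gf n)`_k.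

Definition catalan (k : nat) : rat := (k.+1%:R)^-1 * 'C(2 * k, k)%:R.

Lemma dual_fibonacci_gfP :
  dual_fibonacci_gf 0 = 0 /\
  dual_fibonacci_gf / (1 - y *: dual_fibonacci_gf - dual_fibonacci_gf ^+ 2)
  = fpsX.
Proof.
have [f0 f1] := quad_coef01 y 1.
have [|u0 uE] := reversionP f0; first by rewrite f1 unitr1.
move: u0 uE; rewrite scale1r -/fibonacci_gf -/dual_fibonacci_gf => u0.
by move: (fps_comp_quad y 1 u0); rewrite !scale1r => ->.
Qed.

Lemma dual_fibonacci_gf_unique (u : fps {poly rat}) :
  u 0 = 0 -> u / (1 - y *: u - u ^+ 2) = fpsX -> u = dual_fibonacci_gf.
Proof.
move=> u0 uE; have [f0 f1] := quad_coef01 y 1.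
have fU : (fpsX / (1 - y *: fpsX - 1 *: fpsX ^+ 2) : fps _) 1 \is a GRing.unit.
  by rewrite f1 unitr1.
move: f0 fU; rewrite scale1r => f0 fU.
apply: (reversion_unique f0 fU); last exact: (reversionP f0 fU).
by split => //; move: (fps_comp_quad y 1 u0); rewrite !scale1r => ->.
Qed.

Lemma inversion_reversion (v : fps {poly rat}) :
  is_inversion_gf v <->
  is_reversion (fpsX / (1 - 1 *: fpsX - y *: fpsX ^+ 2)) v.
Proof.
by split=> -[v0 vE]; split=> //; move: vE; rewrite fps_comp_quad // scale1r.
Qed.

Lemma inversion_gfP :
  inversion_gf 0 = 0 /\
  inversion_gf / (1 - inversion_gf - y *: inversion_gf ^+ 2) = fpsX.
Proof.
have [f0 f1] := quad_coef01 1 y.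
have [|v /inversion_reversion vP] := reversion_ex f0; first by rewrite f1 unitr1.
by apply: (xgetPex 0 (ex_intro _ v vP)).
Qed.

Lemma inversion_gf_unique (v : fps {poly rat}) :
  v 0 = 0 -> v / (1 - v - y *: v ^+ 2) = fpsX -> v = inversion_gf.
Proof.
move=> v0 vE; have [f0 f1] := quad_coef01 1 y.
apply: (reversion_unique f0); first by rewrite f1 unitr1.
  by apply/inversion_reversion.
by apply/inversion_reversion; apply: inversion_gfP.
Qed.

(* Main.v *)
Require Import Defs.
From mathcomp Require Import all_boot all_order all_algebra.
From mathcomp Require Import ring.

Set Implicit Arguments.
Unset Strict Implicit.
Unset Printing Implicit Defensive.

Import GRing.Theory Num.Theory.
Local Open Scope ring_scope.

(** Both generating functions are instances of one series: the solution [w],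
    without constant term, of [w = x (1 - a w - b w^2)], taken at
    [(a, b) = (y, 1)] for the dual Fibonacci polynomials and at
    [(a, b) = (1, y)] for the inversion of the matrix of binomials.  So it is
    enough to solve this quadratic equation explicitly, for all [a] and [b].

    Write [w = x g] and [p = 1 / (1 + a x)].  The equation for [g] is
    [(1 + a x) g = 1 - b x^2 g^2]; with [g = p c] and [z = - b x^2 p^2] it
    becomes [c = 1 + z c^2], which is the equation of the Catalan generating
    function evaluated at [z].  Hence [g = p C(z)], that is
      [g = sum_k C_k (-b)^k x^(2k) / (1 + a x)^(2k+1)],
    and the negative binomial series [geom_gfX] reads off the coefficient
      [sum_k 'C(n, 2k) C_k (-1)^(n-k) a^(n-2k) b^k]
    of [x^n] ([quad_gf_coef], [quad_gfE]).  Uniqueness of the solution then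
    identifies the two generating functions.

    The functional equation of the Catalan series is derived from the closed
    form of the Catalan numbers through a differential equation
    ([catalan_gfE]); it can be transported to [z] because composition with a
    series without constant term is multiplicative ([fps_compM]). *)

(** * Formal power series *)

Section FormalPowerSeries.
Variable R : comNzRingType.
Implicit Types f g u : fps R.

Lemma fpsMnE f m n : (f *+ m) n = f n *+ m.
Proof. by elim: m => // m IH; rewrite !mulrS fpsDE IH. Qed.

Lemma fpsXnM m f n :
  (fpsX ^+ m * f) n = if (m <= n)%N then f (n - m)%N else 0.
Proof.
elim: m n => [|m IH] n; first by rewrite mul1r subn0.
by rewrite exprS -mulrA fpsXM; case: n => // n; rewrite IH ltnS subSS.
Qed.

Lemma fps_head_tail f : f = f 0 *: 1 + fpsX * fps_divX f.
Proof.
apply/fpsP => -[|n]; rewrite fpsDE fpsZE fps1E fpsXM.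
  by rewrite mulr1 addr0.
by rewrite mulr0 add0r.
Qed.

(** The operator [x d/dx]: unlike [d/dx] it does not shift the coefficients,
    so that the Leibniz rule holds term by term in the Cauchy product. *)
Definition fps_euler f : fps R := Fps (fun n => n%:R * f n).

Lemma fps_eulerE f n : fps_euler f n = n%:R * f n.
Proof. by []. Qed.

Lemma fps_eulerM f g : fps_euler (f * g) = fps_euler f * g + f * fps_euler g.
Proof.
apply/fpsP => n; rewrite fpsDE fps_eulerE !fpsME mulr_sumr -big_split /=.
apply: eq_bigr => i _.
have -> : n%:R = i%:R + (n - i)%:R :> R by rewrite -natrD subnKC // -ltnS.
by ring.
Qed.

Lemma fps_comp1 u : fps_comp 1 u = 1.
Proof.
apply/fpsP => n; rewrite fps_compcoef big_ord_recl big1 => [|i _].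
  by rewrite addr0 mul1r expr0.
by rewrite mul0r.
Qed.

(** Strong induction on the degree [n] of the coefficient compared: in
    [f = f_0 + x f'] the term [f_0] contributes by linearity, and since
    [u 0 = 0], the coefficient of degree [n] in [u * (f' g)(u)] involves
    [(f' g)(u)] in degrees less than [n] only. *)
Lemma fps_compM f g u : u 0 = 0 ->
  fps_comp (f * g) u = fps_comp f u * fps_comp g u.
Proof.
move=> u0; apply/fpsP => n; elim/ltn_ind: n f => n IH f.
rewrite [in LHS](fps_head_tail f) [in RHS](fps_head_tail f).
rewrite mulrDl -scalerAl mul1r -mulrA.
rewrite !fps_compD !fps_compZ !fps_compXM // fps_comp1.
rewrite mulrDl -scalerAl mul1r -mulrA !fpsDE; congr (_ + _).
rewrite !fpsME; apply: eq_bigr => -[[|i] /= lt_i] _; first by rewrite u0 !mul0r.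
by rewrite IH // ltn_subrL /=; case: n lt_i {IH}.
Qed.

(** The infinite sum [g(u) = sum_k g_k u^k] may be multiplied by [f] term by
    term: in degree [n] it is the finite sum over [k <= n]. *)
Lemma fpsM_comp f g u n : u 0 = 0 ->
  (f * fps_comp g u) n = \sum_(k < n.+1) g k * (f * u ^+ k) n.
Proof.
move=> u0; transitivity ((f * (\sum_(k < n.+1) g k *: u ^+ k)) n).
  rewrite !fpsME; apply: eq_bigr => i _; congr (_ * _).
  rewrite (@fps_compE _ _ _ _ n.+1) ?ltnS ?leq_subr // fps_sumE.
  by apply: eq_bigr => k _; rewrite fpsZE.
rewrite mulr_sumr fps_sumE; apply: eq_bigr => k _.
by rewrite -scalerAr fpsZE.
Qed.

(** The series [1 / (1 + a x)], given by its coefficients. *)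
Definition geom_gf (a : R) : fps R := Fps (fun n => (- a) ^+ n).

Lemma lin_mul_coef (a : R) f n :
  ((1 + a *: fpsX) * f) n = f n + a * (if n is m.+1 then f m else 0).
Proof. by rewrite mulrDl mul1r -scalerAl fpsDE fpsZE fpsXM. Qed.

Lemma geom_gfE (a : R) : (1 + a *: fpsX) * geom_gf a = 1.
Proof.
apply/fpsP => -[|n]; rewrite lin_mul_coef fps1E /=; first by rewrite mulr0 addr0.
by rewrite exprS; ring.
Qed.

(** Negative binomial series: by Pascal's rule, multiplying the series on the
    right-hand side for [m.+1] by [1 + a x] gives the one for [m]. *)
Lemma geom_gfX (a : R) m n :
  (geom_gf a ^+ m.+1) n = 'C(n + m, m)%:R * (- a) ^+ n.
Proof.
pose P m : fps R := Fps (fun n => 'C(n + m, m)%:R * (- a) ^+ n).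
have P0 : P 0 = geom_gf a by apply/fpsP => k; rewrite /= bin0 mul1r.
have PS k : (1 + a *: fpsX) * P k.+1 = P k.
  apply/fpsP => -[|j]; rewrite lin_mul_coef /=.
    by rewrite !add0n !binn mulr0 addr0.
  by rewrite (addSn j k.+1) binS natrD (addSnnS j k) exprS; ring.
suff -> : geom_gf a ^+ m.+1 = P m by [].
elim: m => [|m IH]; first by rewrite expr1.
by rewrite exprS IH -PS mulrA (mulrC (geom_gf a)) geom_gfE mul1r.
Qed.

End FormalPowerSeries.

(** * The Catalan generating function *)

Lemma natS_neq0 n : n.+1%:R != 0 :> rat.
Proof. by rewrite pnatr_eq0. Qed.

Lemma catalan0 : catalan 0 = 1.
Proof. by rewrite /catalan bin0 invr1 mul1r. Qed.

(** Passing from ['C(2n, n)] to ['C(2n+2, n+1)] takes the absorption identity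
    twice, with the symmetry ['C(2n+1, n) = 'C(2n+1, n+1)] in between. *)
Lemma catalan_rec n : n.+2%:R * catalan n.+1 = (4 * n + 2)%:R * catalan n.
Proof.
have E : (n.+1 * 'C(2 * n.+1, n.+1) = (4 * n + 2) * 'C(2 * n, n))%N.
  apply/eqP; rewrite -(eqn_pmul2l (ltn0Sn n)); apply/eqP.
  rewrite [(2 * n.+1)%N]mulnS !add2n -mul_bin_diag /=.
  have -> : 'C((2 * n).+1, n) = 'C((2 * n).+1, n.+1).
    rewrite -[LHS]bin_sub; last by rewrite mul2n -addnn -addSn leq_addl.
    by rewrite mul2n -addnn -addSn addnK.
  rewrite mulnCA -mul_bin_diag /=.
  by ring.
have /(congr1 (fun k => k%:R : rat)) := E.
rewrite !natrM /catalan => E'.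
rewrite mulVKf ?pnatr_eq0 //; apply: (mulfI (natS_neq0 n)).
by rewrite E' mulrCA mulVKf ?pnatr_eq0.
Qed.

Definition catalan_gf : fps rat := Fps catalan.

(** The series [s = 1 - 2 x C(x)] should be the square root of [1 - 4 x].
    The recurrence [catalan_rec] says that [s] satisfies the first-order
    differential equation of this square root, hence [t = s^2] satisfies the
    one of [1 - 4 x]; such an equation and the constant term determine a
    series.  Expanding [s^2 = 1 - 4 x] and cancelling [4 x] gives the claim. *)
Lemma catalan_gfE : catalan_gf = 1 + fpsX * catalan_gf ^+ 2.
Proof.
set c := catalan_gf.
have [s sE] : exists s, s = 1 - fpsX * c *+ 2 by eexists.
have sS n : s n.+1 = - (catalan n *+ 2).
  by rewrite sE fpsBE fps1E sub0r fpsMnE fpsXM.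
have s0 : s 0 = 1 by rewrite sE fpsBE fpsMnE fpsXM mul0rn subr0.
have s_ode : fps_euler s = fpsX * (fps_euler s *+ 4 - s *+ 2).
  apply/fpsP => -[|n]; rewrite fps_eulerE fpsXM; first by rewrite mul0r.
  rewrite !(fpsBE, fpsMnE, fps_eulerE) sS.
  case: n => [|n].
    by rewrite s0 catalan0; ring.
  rewrite sS; have := catalan_rec n; move: (catalan _) (catalan _) => x z E.
  by rewrite mulrN mulrnAr E; ring.
pose t := s ^+ 2.
have t_ode : fps_euler t = fpsX * (fps_euler t *+ 4 - t *+ 4).
  have -> : fps_euler t = s * fps_euler s *+ 2.
    by rewrite /t expr2 fps_eulerM; ring.
  by rewrite {1}s_ode /t; ring.
have tS n : n.+1%:R * t n.+1 = (n%:R *+ 4 - 4) * t n.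
  have /fpsP/(_ n.+1) := t_ode.
  rewrite fps_eulerE fpsXM => ->.
  by rewrite !(fpsBE, fpsMnE, fps_eulerE); ring.
have t0 : t 0 = 1 by rewrite /t expr2 fpsM0 s0 mulr1.
have t1 : t 1 = - 4.
  by have := tS 0; rewrite t0 mul1r mulr1 => ->; ring.
have t2 n : t n.+2 = 0.
  have eq0 k : k.+1%:R * t k.+1 = 0 -> t k.+1 = 0.
    by move/eqP; rewrite mulf_eq0 (negbTE (natS_neq0 k)) => /eqP.
  by elim: n => [|n IH]; apply: eq0; rewrite tS ?t1 ?IH; ring.
have tE : t = 1 - fpsX *+ 4.
  apply/fpsP => -[|[|n]]; rewrite fpsBE fps1E fpsMnE fpsXE /= ?mulr0n ?mulr1n.
  - by rewrite t0; ring.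
  - by rewrite t1; ring.
  - by rewrite t2; ring.
have E : fpsX * (c - 1 - fpsX * c ^+ 2) *+ 4 = 0.
  apply/eqP; rewrite -[_ *+ 4]opprK oppr_eq0.
  have -> : - (fpsX * (c - 1 - fpsX * c ^+ 2) *+ 4) = t - (1 - fpsX *+ 4).
    by rewrite /t sE; ring.
  by rewrite tE subrr.
apply/eqP; rewrite -subr_eq0 opprD addrA; apply/eqP/fpsP => n.
have /fpsP/(_ n.+1) := E; rewrite fpsMnE fpsXM fps0E.
move: (_ n) => x /eqP.
have -> : x *+ 4 = 4%:R * x by ring.
by rewrite mulf_eq0 pnatr_eq0 /= => /eqP.
Qed.

(** * The equation w = x (1 - a w - b w^2) *)

Section QuadraticEquation.
Variable R : comUnitAlgType rat.
Variables a b : R.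

Definition catalan_gfA : fps R := Fps (fun k => (catalan k)%:A).

Lemma catalan_gfAE : catalan_gfA = 1 + fpsX * catalan_gfA ^+ 2.
Proof.
apply/fpsP => n; have /fpsP/(_ n) := catalan_gfE.
rewrite !fpsDE !fpsXM !fps1E /= => ->; rewrite scalerDl; congr (_ + _).
  by rewrite scaler_nat.
case: n => [|n]; first by rewrite scale0r.
rewrite !expr2 !fpsME scaler_suml; apply: eq_bigr => i _ /=.
by rewrite -scalerAl mul1r scalerA.
Qed.

Let z : fps R := - b *: (fpsX * geom_gf a) ^+ 2.

Let z0 : z 0 = 0.
Proof. by rewrite /z fpsZE expr2 -mulrA fpsXM mulr0. Qed.

(** The series [w / x], for the solution [w] of the quadratic equation. *)
Definition quad_gf : fps R := geom_gf a * fps_comp catalan_gfA z.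

(** The [k]-th term of [p C(z)] is a multiple of [x^(2k) p^(2k+1)], whose
    coefficient of degree [n] is [(-a)^(n-2k)] times the binomial [n] over
    [2k], and [0] when [n < 2k]. *)
Lemma quad_gf_coef n :
  quad_gf n = \sum_(0 <= k < (n %/ 2).+1)
    ('C(n, 2 * k)%:R * catalan k * (-1) ^+ (n - k)) *: (a ^+ (n - 2 * k) * b ^+ k).
Proof.
rewrite fpsM_comp // big_mkord.
rewrite (big_ord_widen n.+1 (fun k =>
    ('C(n, 2 * k)%:R * catalan k * (-1) ^+ (n - k)) *:
      (a ^+ (n - 2 * k) * b ^+ k))) ?ltnS ?leq_div // [RHS]big_mkcond /=.
apply: eq_bigr => k _.
have -> : geom_gf a * z ^+ k
    = (- b) ^+ k *: (fpsX ^+ (2 * k) * geom_gf a ^+ (2 * k).+1).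
  by rewrite /z exprZn -exprM exprMn -scalerAr exprS mulrCA.
rewrite fpsZE fpsXnM geom_gfX ltnS leq_divRL // (mulnC k).
case: ifP => [le_kn|_]; last by rewrite !mulr0.
rewrite subnK // /= (exprNn a) (exprNn b).
have -> : (n - k = k + (n - 2 * k))%N.
  by rewrite addnBA // mul2n -addnn subnDl.
rewrite -[RHS]mulr_algl.
have -> : ('C(n, 2 * k)%:R * catalan k * (-1) ^+ (k + (n - 2 * k)))%:A
    = 'C(n, 2 * k)%:R * (catalan k)%:A * (-1) ^+ (k + (n - 2 * k)) :> R.
  by rewrite -[LHS]/(in_alg R _) rmorphM rmorphM rmorph_nat rmorph_sign.
rewrite exprD /=; ring.
Qed.

Let quad_unit (w : fps R) : w 0 = 0 ->
  1 - a *: w - b *: w ^+ 2 \is a GRing.unit.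
Proof.
move=> w0.
by rewrite fps_unitE !fpsBE !fpsZE expr2 fpsM0 w0 !mulr0 !subr0 unitr1.
Qed.

(** Multiplying [C(z) = 1 + z C(z)^2] out gives the equation of [quad_gf],
    because [(1 + a x) p = 1] and [z C(z)^2 = - b (x p C(z))^2]. *)
Lemma quad_gfE : let w := fpsX * quad_gf in
  w / (1 - a *: w - b *: w ^+ 2) = fpsX.
Proof.
move=> w; have qU : 1 - a *: w - b *: w ^+ 2 \is a GRing.unit.
  by apply: quad_unit; rewrite /w fpsXM.
apply: (mulIr qU); rewrite divrK // /w; congr (fpsX * _).
set p := geom_gf a; set c := fps_comp catalan_gfA z.
have cE : c = 1 + z * c ^+ 2.
  by rewrite /c {1}catalan_gfAE fps_compD fps_comp1 fps_compXM // !expr2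
             fps_compM.
have gE : (1 + a *: fpsX) * quad_gf = c by rewrite mulrA geom_gfE mul1r.
transitivity ((1 + a *: fpsX) * quad_gf - a *: (fpsX * quad_gf)).
  by rewrite mulrDl mul1r -scalerAl addrK.
rewrite gE {1}cE addrAC; congr (_ - _ + _).
by rewrite /z /quad_gf -/c -/p scaleNr mulNr -scalerAl -exprMn mulrA.
Qed.

End QuadraticEquation.

(** * Dual Fibonacci polynomials *)

Theorem proposition6 (n : nat) :
  dual_fibonacci n.+1
    = \sum_(0 <= k < (n %/ 2).+1) ttilde2 n k *: 'X^(n - 2 * k)
  /\
  \sum_(0 <= k < (n %/ 2).+1) ttilde2 n k *: 'X^(n - 2 * k)
    = \sum_(0 <= k < (n %/ 2).+1)
        ('C(n, 2 * k)%:R * catalan k * (-1) ^+ (n - k)) *: 'X^(n - 2 * k)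
    :> {poly rat}.
Proof.
have dual : dual_fibonacci_gf = fpsX * quad_gf 'X 1.
  apply/esym/dual_fibonacci_gf_unique; first by rewrite fpsXM.
  by have := quad_gfE 'X 1; rewrite /= scale1r.
have inv : inversion_gf = fpsX * quad_gf 1 'X.
  apply/esym/inversion_gf_unique; first by rewrite fpsXM.
  by have := quad_gfE 1 'X; rewrite /= scale1r.
have tE k : (k < (n %/ 2).+1)%N ->
    ttilde2 n k = 'C(n, 2 * k)%:R * catalan k * (-1) ^+ (n - k).
  (* In the coefficient of [x^n], a polynomial in [y], only the term of index
     [k] has degree [k]. *)
  move=> lt_k; rewrite /ttilde2 inv /= fpsXM quad_gf_coef big_mkord coef_sum.
  rewrite (bigD1 (Ordinal lt_k)) //= coefZ expr1n mul1r coefXn eqxx mulr1.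
  rewrite big1 ?addr0 // => i; rewrite -val_eqE /= => ik.
  by rewrite coefZ expr1n mul1r coefXn eq_sym (negbTE ik) mulr0.
have sE : \sum_(0 <= k < (n %/ 2).+1) ttilde2 n k *: 'X^(n - 2 * k)
    = \sum_(0 <= k < (n %/ 2).+1)
        ('C(n, 2 * k)%:R * catalan k * (-1) ^+ (n - k)) *: 'X^(n - 2 * k)
      :> {poly rat}.
  by rewrite !big_mkord; apply: eq_bigr => k _; rewrite tE.
split=> //; rewrite sE /dual_fibonacci dual fpsXM quad_gf_coef.
by apply: eq_bigr => k _; rewrite expr1n mulr1.
Qed.
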